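(* For $n\geq 4$, the number of permutations $\pi\in\mathcal{S}_n$ such that $\pi$, $\theta(\pi)$ and $\theta^2(\pi)$ all avoid $213$ equals $\binom{n+1}{2}$.
   Context: $\mathcal{S}_n$ is the symmetric group on $[n]$, permutations in one-line notation $\pi_1\cdots\pi_n$. A permutation avoids a pattern $\tau$ if it has no subsequence order-isomorphic to $\tau$. The standard cycle notation of $\pi$ writes each cycle (fixed points included) with its largest element first and orders cycles by increasing largest element. The fundamental bijection $\theta:\mathcal{S}_n\to\mathcal{S}_n$ maps $\pi$ to the permutation whose one-line notation is obtained by erasing the parentheses of the standard cycle notation of $\pi$; $\theta^k$ denotes its $k$-fold composition. *)

(* Defs.v *)
From mathcomp Require Import all_boot all_fingroup.

Set Implicit Arguments.
Unset Strict Implicit.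
Unset Printing Implicit Defensive.

(* Permutations of [n] are elements of 'S_n, acting on {0, ..., n-1} rather   *)
(* than {1, ..., n}.                                                         *)

(* The pattern tau is a word of naturals; only the relative order of its     *)
(* letters matters.                                                          *)
Definition contains n (pi : 'S_n) (tau : seq nat) : bool :=
  [exists f : {ffun 'I_(size tau) -> 'I_n},
    [forall i : 'I_(size tau), forall j : 'I_(size tau),
       (i < j) ==> (f i < f j)] &&
    [forall i : 'I_(size tau), forall j : 'I_(size tau),
       (pi (f i) < pi (f j)) == (nth 0 tau i < nth 0 tau j)]].

Definition avoids n (pi : 'S_n) (tau : seq nat) : bool := ~~ contains pi tau.

(* Increasing, because enum 'I_n is. *)
Definition cycle_maxima n (pi : 'S_n) : seq 'I_n :=
  [seq m <- enum 'I_n | [forall j in porbit pi m, j <= m]].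

(* Each cycle is written (m, pi m, pi (pi m), ...) from its largest entry m. *)
Definition standard_cycles n (pi : 'S_n) : seq (seq 'I_n) :=
  [seq traject pi m #|porbit pi m| | m <- cycle_maxima pi].

Definition theta_word n (pi : 'S_n) : seq 'I_n := flatten (standard_cycles pi).

Lemma mem_theta_word n (pi : 'S_n) (x : 'I_n) : x \in theta_word pi.
Proof.
case: (@arg_maxnP _ x (fun j => j \in porbit pi x) (@nat_of_ord n)
         (porbit_id pi x)) => m mx max_m.
apply/flattenP; exists (traject pi m #|porbit pi m|).
  apply: map_f; rewrite mem_filter mem_enum andbT.
  apply/forall_inP => j jm; apply: max_m.
  by rewrite -eq_porbit_mem in mx; rewrite -(eqP mx).
by rewrite -porbit_traject porbit_sym.
Qed.

Lemma theta_word_uniq n (pi : 'S_n) : uniq (theta_word pi).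
Proof.
rewrite /theta_word /standard_cycles.
have: uniq (cycle_maxima pi) by rewrite filter_uniq ?enum_uniq.
have: all (fun m : 'I_n => [forall j in porbit pi m, j <= m]) (cycle_maxima pi).
  exact: filter_all.
elim: (cycle_maxima pi) => //= m ms IHms /andP[m_max ms_max] /andP[m_ms ms_uniq].
rewrite cat_uniq uniq_traject_porbit IHms // andbT.
apply: contra m_ms => /hasP[x /flatten_mapP[m' m'_ms]].
rewrite -!porbit_traject -!eq_porbit_mem => /eqP-> /eqP eq_mm'.
suff -> : m = m' by [].
apply/val_inj/eqP; rewrite eqn_leq.
rewrite (forall_inP (allP ms_max _ m'_ms)) ?eq_mm' ?porbit_id //.
by rewrite (forall_inP m_max) // -eq_mm' porbit_id.
Qed.

Lemma size_theta_word n (pi : 'S_n) : size (theta_word pi) = n.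
Proof.
rewrite -[RHS](size_enum_ord n); apply/eqP.
rewrite -uniq_size_uniq ?theta_word_uniq ?enum_uniq //.
by move=> x; rewrite mem_theta_word mem_enum.
Qed.

(* The default value of nth is never used, by size_theta_word. *)
Lemma theta_inj n (pi : 'S_n) :
  injective (fun i : 'I_n => nth i (theta_word pi) i).
Proof.
move=> i j; rewrite (set_nth_default i j) ?size_theta_word // => /eqP.
by rewrite nth_uniq ?size_theta_word ?theta_word_uniq // => /eqP/val_inj.
Qed.

Definition theta n (pi : 'S_n) : 'S_n := perm (@theta_inj n pi).

(* Main.v *)
Require Import Defs.
From mathcomp Require Import all_boot all_fingroup.
From mathcomp Require Import zify.

Set Implicit Arguments.
Unset Strict Implicit.
Unset Printing Implicit Defensive.

(* Write [N = n - 1], [sigma = theta pi] and [tau = theta sigma].  If [sigma]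
   avoids 213, then every cycle of [pi] not containing [N] is a fixed point: the
   maximum [m] of a longer cycle would give the pattern [m, pi m, N] in [sigma].
   Hence [sigma] is an increasing list of fixed points of [pi] followed by
   [N, pi N, pi (pi N), ...], and [pi] and [sigma] determine each other;
   the same holds for [sigma] and [tau].

   The good [pi] fixing [0] correspond to the good permutations of [n - 1]
   points.
   If [pi] moves [0], playing the three avoidance conditions against each other
   leaves only [sigma = N 0 1 .. k-1 k+1 .. N-1 k] with [k < N],
   [sigma = 1 2 .. N 0], and, for [n = 4] only, [sigma = 2 3 1 0].  So for
   [n >= 3] there are [n] such [pi], or [n + 1] when [n = 4], and the extra
   permutation makes up for the coincidence of the two families at [n = 2]. *)

(** * Words of permutations with a single nontrivial cycle *)

(** Passing to functions on [nat] leaves the order arguments to [lia]; statements about them are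
    bounded by [N]. *)
Definition nat_fun N (s : 'S_N.+1) (i : nat) : nat := s (inord i).

Definition av213 N (f : nat -> nat) : Prop :=
  forall i j k, i < j -> j < k -> k <= N -> f j < f i -> f i < f k -> False.

Lemma nat_funE N (s : 'S_N.+1) (i : 'I_N.+1) : nat_fun s i = s i.
Proof. by rewrite /nat_fun inord_val. Qed.

Lemma nat_fun_ord N (s : 'S_N.+1) i (hi : i < N.+1) :
  nat_fun s i = s (Ordinal hi).
Proof. exact: (nat_funE s (Ordinal hi)). Qed.

Lemma avoids213P N (s : 'S_N.+1) :
  reflect (av213 N (nat_fun s)) (avoids s [:: 2; 1; 3]).
Proof.
apply: (iffP negP) => [H i j k ij jk kN ji ik | H].
  have hi : i < N.+1 by lia.
  have hj : j < N.+1 by lia.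
  have hk : k < N.+1 by lia.
  move: ji ik; rewrite !nat_fun_ord => ji ik.
  apply: H; apply/existsP.
  exists [ffun x : 'I_3 => tnth [tuple Ordinal hi; Ordinal hj; Ordinal hk] x].
  apply/andP; split; apply/forallP => x; apply/forallP => y; rewrite !ffunE.
    case: x => [[|[|[|x]]]] // hx; case: y => [[|[|[|y]]]] // hy;
      by rewrite !(tnth_nth (Ordinal hi)) /=; lia.
  case: x => [[|[|[|x]]]] // hx; case: y => [[|[|[|y]]]] // hy;
    rewrite !(tnth_nth (Ordinal hi)) /=; lia.
move=> /existsP[f /andP[/forallP f_lt /forallP f_pat]].
pose o (m : nat) (hm : m < 3) : 'I_3 := Ordinal hm.
pose a := f (@o 0 isT); pose b := f (@o 1 isT); pose c := f (@o 2 isT).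
have ab : a < b by have /forallP/(_ (@o 1 isT)) := f_lt (@o 0 isT).
have bc : b < c by have /forallP/(_ (@o 2 isT)) := f_lt (@o 1 isT).
have sba : s b < s a.
  by have /forallP/(_ (@o 0 isT))/eqP /= -> := f_pat (@o 1 isT).
have sac : s a < s c.
  by have /forallP/(_ (@o 2 isT))/eqP /= -> := f_pat (@o 0 isT).
apply: (H a b c) => //; rewrite ?nat_funE //.
by rewrite -ltnS ltn_ord.
Qed.

(* [s] lists the fixed points of [p] below [N] increasingly in positions
   [0 .. r-1] and then the remaining points as one cycle [N, p N, ...]. *)
Definition fund_word N (p s : nat -> nat) (r : nat) : Prop :=
  [/\ r <= N /\ s r = N,
      forall i j, i < j -> j <= r -> s i < s j,
      forall i, i < r -> p (s i) = s i,
      forall j, r <= j -> j < N -> s j.+1 = p (s j) &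
      p (s N) = N].

(** [theta] uses the index itself as default of [nth]; a fixed default is needed to rewrite inside
    the word. *)
Lemma nat_fun_theta N (pi : 'S_N.+1) i : i <= N ->
  nat_fun (theta pi) i = nth ord_max (theta_word pi) i.
Proof.
move=> iN; rewrite /nat_fun permE inordK //; congr val.
by apply: set_nth_default; rewrite size_theta_word.
Qed.

Lemma mem_porbit1 (T : finType) (s : {perm T}) x : s x \in porbit s x.
Proof. by rewrite -[s x]/((s ^+ 1)%g x) mem_porbit. Qed.

Lemma porbit_fix (T : finType) (s : {perm T}) x :
  s x = x -> porbit s x = [set x].
Proof.
move=> sx; apply/setP => y; rewrite inE; apply/porbitP/eqP => [[i ->]|->].
  by rewrite permX iter_fix.
by exists 0; rewrite expg0 perm1.
Qed.

Section Theta.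
Variables (N : nat) (pi : 'S_N.+1).

Let one_cycle := forall x, pi x = x \/ x \in porbit pi ord_max.

Lemma avoids_theta_one_cycle : avoids (theta pi) [:: 2; 1; 3] -> one_cycle.
Proof.
move=> /avoids213P av x.
case: (@arg_maxnP _ x (fun j => j \in porbit pi x) (@nat_of_ord N.+1)
         (porbit_id pi x)) => m mx max_m.
have eq_mx : porbit pi m = porbit pi x.
  by apply/eqP; rewrite eq_porbit_mem.
case: (eqVneq m ord_max) => [mN | mN].
  by right; rewrite -mN eq_mx porbit_id.
left.
suff pm : pi m = m.
  have : x \in porbit pi m by rewrite eq_mx porbit_id.
  by rewrite porbit_fix // inE => /eqP ->.
apply/eqP/negPn/negP => pm.
have m_max : m \in cycle_maxima pi.
  rewrite mem_filter mem_enum andbT; apply/forall_inP => j.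
  by rewrite eq_mx; exact: max_m.
have N_max : ord_max \in cycle_maxima pi.
  rewrite mem_filter mem_enum andbT; apply/forall_inP => j _.
  by rewrite /= -ltnS.
have srt : sorted (fun x y : 'I_N.+1 => x < y) (cycle_maxima pi).
  apply: sorted_filter; first by move=> a b c; exact: ltn_trans.
  have := iota_ltn_sorted 0 N.+1; rewrite -val_enum_ord.
  by rewrite sorted_map.
have [s1 [s2 Es]] : exists s1 s2, cycle_maxima pi = s1 ++ m :: s2.
  by case/splitPr: m_max => s1 s2; exists s1, s2.
(* The maxima are listed increasingly, so the cycle of [N] is written after that of [m]. *)
have N_s2 : ord_max \in s2.
  move: N_max srt; rewrite Es mem_cat in_cons eq_sym (negPf mN) /=.
  case/orP => // N1.
  rewrite sorted_pairwise; last by move=> a b c; exact: ltn_trans.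
  rewrite pairwise_cat => /and3P[/allrelP /(_ _ m N1)] .
  rewrite mem_head => /(_ isT) /= Nm.
  by have := ltn_ord m; lia.
have [k Ek] : exists k, #|porbit pi m| = k.+2.
  have : [set m; pi m] \subset porbit pi m.
    by rewrite subUset !sub1set porbit_id mem_porbit1.
  move=> /subset_leq_card; rewrite cards2 eq_sym pm.
  by case: #|porbit pi m| => [|[|k]] // _; exists k.
(* [B] is the rest of the cycle of [m] and [C] holds the later cycles, so [m], [pi m] and [N] occur
   in this order. *)
have [A [B [C [Ew NC]]]] :
    exists A B C, theta_word pi = A ++ m :: pi m :: B ++ C /\ ord_max \in C.
  exists (flatten [seq traject pi z #|porbit pi z| | z <- s1]).
  exists (traject pi (pi (pi m)) k).
  exists (flatten [seq traject pi z #|porbit pi z| | z <- s2]); split.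
    by rewrite /theta_word /standard_cycles Es map_cat flatten_cat /= Ek.
  apply/flatten_mapP; exists ord_max => //.
  by rewrite -porbit_traject porbit_id.
have szw := size_theta_word pi.
have lt_pm : pi m < m.
  rewrite ltn_neqAle val_eqE pm; apply: max_m.
  by rewrite -eq_mx mem_porbit1.
have lt_mN : m < N.
  by have := ltn_ord m; rewrite -val_eqE /= in mN; lia.
have iC : index ord_max C < size C by rewrite index_mem.
rewrite Ew size_cat /= size_cat in szw.
have kN : size A + (2 + (size B + index ord_max C)) <= N.
  rewrite -ltnS; apply: leq_trans (eq_leq szw).
  by rewrite ltn_add2l !ltnS ltn_add2l.
have e0 : nat_fun (theta pi) (size A) = m.
  by rewrite nat_fun_theta ?Ew ?nth_cat ?ltnn ?subnn //; lia.
have e1 : nat_fun (theta pi) (size A).+1 = pi m.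
  rewrite nat_fun_theta; last lia.
  by rewrite Ew nth_cat ltnNge leqnSn /= subSnn.
have e2 : nat_fun (theta pi) (size A + (2 + (size B + index ord_max C))) = N.
  rewrite nat_fun_theta // Ew nth_cat ltnNge leq_addr /= addKn /=.
  by rewrite add0n nth_cat ltnNge leq_addr /= addKn nth_index.
apply: (av (size A) (size A).+1 (size A + (2 + (size B + index ord_max C)))).
- lia.
- lia.
- exact: kN.
- by rewrite e0 e1.
- by rewrite e0 e2.
Qed.

(** The shape that [enum_ordSr] produces when it splits [ord_max] off the enumeration. *)
Let low := [seq widen_ord (leqnSn N) i | i <- enum 'I_N].
Let fixed_low := [seq x <- low | pi x == x].

Lemma mem_low_lt x : x \in low -> x < N.
Proof. by case/mapP => i _ -> /=. Qed.

Lemma theta_word_one_cycle : one_cycle ->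
  theta_word pi = fixed_low ++ traject pi ord_max #|porbit pi ord_max|.
Proof.
move=> H.
suff Em : cycle_maxima pi = rcons fixed_low ord_max.
  rewrite /theta_word /standard_cycles Em map_rcons flatten_rcons; congr cat.
  have : all (fun x => pi x == x) fixed_low by exact: filter_all.
  elim: fixed_low => //= x s IH /andP[/eqP px /IH ->].
  by rewrite porbit_fix // cards1.
rewrite /cycle_maxima enum_ordSr filter_rcons.
have -> : [forall j in porbit pi ord_max, j <= @ord_max N].
  by apply/forall_inP => j _; rewrite /= -ltnS.
congr rcons; apply: eq_in_filter => x /mem_low_lt xN.
(* A moved point below [N] shares the cycle of [N], so it is not the maximum of its cycle. *)
apply/forall_inP/eqP => [mx | px j].
  case: (H x) => // xo; exfalso.
  have := mx ord_max; rewrite porbit_sym xo => /(_ isT) /=; lia.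
by rewrite porbit_fix // inE => /eqP ->.
Qed.

Lemma one_cycle_fund_word : one_cycle ->
  exists r, fund_word N (nat_fun pi) (nat_fun (theta pi)) r.
Proof.
move=> H; have Ew := theta_word_one_cycle H.
have szw := size_theta_word pi; rewrite Ew size_cat size_traject in szw.
have c0 : 0 < #|porbit pi ord_max|.
  by apply/card_gt0P; exists ord_max; exact: porbit_id.
(* [r] counts the fixed points below [N]; it is also the position of [N] in the word. *)
set r := size fixed_low in szw.
have sE1 i : i < r -> nat_fun (theta pi) i = nth ord_max fixed_low i.
  by move=> ir; rewrite nat_fun_theta ?Ew ?nth_cat ?ir //; lia.
have sE2 i : r <= i -> i <= N ->
    nat_fun (theta pi) i = iter (i - r) pi ord_max.
  move=> ri iN; rewrite nat_fun_theta // Ew nth_cat -/r ltnNge ri /=.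
  by rewrite nth_traject // -(ltn_add2l r) szw subnKC.
have rN : r <= N by lia.
have memF i : i < r -> pi (nth ord_max fixed_low i) = nth ord_max fixed_low i
                       /\ nth ord_max fixed_low i < N.
  move=> ir; have := mem_nth ord_max ir.
  by rewrite mem_filter => /andP[/eqP -> /mem_low_lt].
exists r; split.
- by split => //; rewrite sE2 // subnn.
- move=> i j ij; rewrite leq_eqVlt => /orP[/eqP jr | jr].
    rewrite jr (sE2 r) // subnn sE1; last by lia.
    by case: (memF i) => //; lia.
  rewrite !sE1 //; last by lia.
  have srt : sorted (fun x y : 'I_N.+1 => x < y) fixed_low.
    apply: sorted_filter; first by move=> a b c; exact: ltn_trans.
    have := iota_ltn_sorted 0 N; rewrite -val_enum_ord.
    by rewrite /low !sorted_map.
  have := sorted_ltn_nth _ ord_max srt; rewrite -/r; apply => //.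
    by move=> a b c; exact: ltn_trans.
  by rewrite inE; lia.
- by move=> i ir; rewrite sE1 // nat_funE; case: (memF i ir) => ->.
- move=> j rj jN; rewrite !sE2 //; try lia.
  by rewrite nat_funE subSn.
(* The last letter is [N] moved [N - r] times; one more step closes the orbit, which has [N - r + 1]
   points. *)
- rewrite sE2 // nat_funE -iterS.
  have -> : (N - r).+1 = #|porbit pi ord_max| by lia.
  by rewrite iter_porbit.
Qed.

End Theta.

(** * Fundamental words and permutations determine each other *)

Definition nat_perm N (f : nat -> nat) : Prop :=
  [/\ forall i, i <= N -> f i <= N,
      forall i j, i <= N -> j <= N -> f i = f j -> i = j &
      forall y, y <= N -> exists2 x, x <= N & f x = y].

Lemma nat_fun_perm N (s : 'S_N.+1) : nat_perm N (nat_fun s).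
Proof.
split.
- by move=> i _; rewrite /nat_fun -ltnS.
- move=> i j iN jN /val_inj /perm_inj /(congr1 val) /=.
  by rewrite !inordK.
- move=> y yN; exists (s^-1%g (inord y)); first by rewrite -ltnS.
  by rewrite nat_funE permKV inordK.
Qed.

Lemma nat_fun_inj N (s t : 'S_N.+1) :
  (forall i, i <= N -> nat_fun s i = nat_fun t i) -> s = t.
Proof.
move=> H; apply/permP => x; apply/val_inj.
by rewrite /= -!nat_funE H // -ltnS.
Qed.

(** A fixed letter at a position [i >= r] would give [s i.+1 = s i], or [s N = N] when [i = N]. The
    letter [N] is set apart because it opens the cycle part even when [p] fixes it. *)
Lemma fund_word_fixed N p s r : nat_perm N s -> fund_word N p s r ->
  forall i, i <= N -> (p (s i) = s i /\ s i <> N) <-> i < r.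
Proof.
move=> [sN sI _] [[rN sr] incr fx nx last] i iN; split => [[pf sn]|ir].
  case: (ltnP i r) => // ri; exfalso.
  case: (eqVneq i N) => [iE|/eqP iE]; first by apply: sn; rewrite -pf iE.
  have := nx i ri; rewrite pf => /(_ _) e.
  have /sI : s i.+1 = s i by apply: e; lia.
  by lia.
split; first exact: fx.
by move=> e; have := incr i r ir (leqnn r); lia.
Qed.

(** Both words list the same fixed points increasingly, then start at [N] and iterate [p]. The
    induction on positions carries along that the two fixed parts have not ended separately. *)
Lemma fund_word_word_uniq N p s r s' r' :
  nat_perm N s -> nat_perm N s' -> fund_word N p s r -> fund_word N p s' r' ->
  forall i, i <= N -> s i = s' i.
Proof.
move=> Ps Ps' F F'.
suff H i : i <= N -> s i = s' i /\ (i < r <-> i < r').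
  by move=> i iN; case: (H i iN).
(* One inequality, to be used in both directions: the letter [s1 i] occurs in the fixed part of
   [s2], at a position that cannot precede [i], and that part increases. *)
have half q r1 s1 r2 s2 : nat_perm N s1 -> nat_perm N s2 ->
    fund_word N q s1 r1 -> fund_word N q s2 r2 ->
  forall i, i <= N ->
    (forall j, j < i -> s1 j = s2 j /\ (j < r1 <-> j < r2)) -> i < r1 ->
    i < r2 /\ s2 i <= s1 i.
  move=> P1 P2 F1 F2 i0 iN IH ir.
  have [s1N s1I _] := P1; have [_ _ s2S] := P2.
  have [j jN Ej] := s2S _ (s1N _ iN).
  have f1 := fund_word_fixed P1 F1; have f2 := fund_word_fixed P2 F2.
  have jr2 : j < r2.
    by apply/(f2 j jN); rewrite Ej; apply/(f1 i0 iN).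
  have ij : i0 <= j.
    rewrite leqNgt; apply/negP => ji.
    have [e _] := IH j ji.
    have : s1 j = s1 i0 by rewrite e Ej.
    by move/(s1I _ _ jN iN); lia.
  split; first by lia.
  rewrite -Ej; move: ij; rewrite leq_eqVlt => /orP[/eqP -> //|ij].
  by case: F2 => [_ incr _ _ _]; apply/ltnW/incr => //; exact: ltnW.
elim/ltn_ind: i => i IH iN.
have IH1 j : j < i -> s j = s' j /\ (j < r <-> j < r').
  by move=> ji; apply: IH => //; lia.
have IH2 j : j < i -> s' j = s j /\ (j < r' <-> j < r).
  by move=> /IH1 [-> [h1 h2]].
case: (ltnP i r) => ir.
  have [ir' le1] := half _ _ _ _ _ Ps Ps' F F' i iN IH1 ir.
  have [_ le2] := half _ _ _ _ _ Ps' Ps F' F i iN IH2 ir'.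
  by split; [lia | split].
case: (ltnP i r') => ir'.
  by have [] := half _ _ _ _ _ Ps' Ps F' F i iN IH2 ir'; lia.
split; last by [].
case: F => [[rN sr] _ _ nx _]; case: F' => [[rN' sr'] _ _ nx' _].
have rr : r = r'.
  case: (ltngtP r r') => // lt.
    by case: (IH1 r) => [|_ [_]]; lia.
  by case: (IH1 r') => [|_ [+ _]]; lia.
subst r'; case: (eqVneq i r) => [->|ne]; first by rewrite sr sr'.
case: i {IH IH2 ir'} IH1 iN ir ne => [|i] IH iN ir ne; first lia.
rewrite nx ?nx' //; try lia.
by case: (IH i (ltnSn i)) => ->.
Qed.

(** The position of [N] in [s] gives [r]; then [p] fixes earlier letters, sends later ones to their
    successors and the last one to [N]. *)
Lemma fund_word_perm_uniq N p p' s r r' :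
  nat_perm N s -> fund_word N p s r -> fund_word N p' s r' ->
  forall i, i <= N -> p i = p' i.
Proof.
move=> [_ sI sS] [[rN sr] _ fx nx la] [[rN' sr'] _ fx' nx' la'] i iN.
have rr : r = r' by apply: sI => //; rewrite sr sr'.
subst r'; have [j jN <-] := sS i iN.
case: (ltnP j r) => jr; first by rewrite fx ?fx'.
case: (eqVneq j N) => [-> |ne]; first by rewrite la la'.
by rewrite -nx ?nx' //; lia.
Qed.

Lemma avoids_theta_fund_word N (pi : 'S_N.+1) :
  avoids (theta pi) [:: 2; 1; 3] ->
  exists r, fund_word N (nat_fun pi) (nat_fun (theta pi)) r.
Proof. by move/avoids_theta_one_cycle/one_cycle_fund_word. Qed.

(** Computes [theta pi] from an exhibited word: the word itself shows that [pi] has only one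
    nontrivial cycle at most, and uniqueness does the rest. *)
Lemma fund_word_theta N (pi sigma : 'S_N.+1) r :
  fund_word N (nat_fun pi) (nat_fun sigma) r -> theta pi = sigma.
Proof.
move=> F; have Ps := nat_fun_perm sigma.
have [r' F'] : exists r', fund_word N (nat_fun pi) (nat_fun (theta pi)) r'.
  apply: one_cycle_fund_word => x.
  have Ex : x = sigma ((sigma^-1)%g x) by rewrite permKV.
  set j := (sigma^-1)%g x in Ex.
  case: F => [[rN sr] _ fx nx la].
  case: (ltnP j r) => jr.
    left; apply: val_inj => /=; rewrite -nat_funE Ex -(nat_funE sigma j).
    exact: fx.
  right; rewrite Ex.
  (* By induction on the position, every letter from position [r] on lies in the orbit of [N]. *)
  suff H k : r <= k -> k <= N -> sigma (inord k) \in porbit pi ord_max.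
    by have := H j jr; rewrite inord_val; apply; rewrite -ltnS.
  elim: k => [|k IH] rk kN.
    have r0 : r = 0 by lia.
    suff -> : sigma (inord 0) = ord_max by exact: porbit_id.
    by apply/val_inj; rewrite -[LHS]/(nat_fun sigma 0) -r0 sr.
  case: (eqVneq r k.+1) => [e|ne].
    suff -> : sigma (inord k.+1) = ord_max by exact: porbit_id.
    by apply/val_inj; rewrite -[LHS]/(nat_fun sigma k.+1) -e sr.
  have -> : sigma (inord k.+1) = pi (sigma (inord k)).
    apply/val_inj; rewrite -[LHS]/(nat_fun sigma k.+1) nx; try lia.
    by rewrite /nat_fun inord_val.
  have := IH _ _; rewrite -!eq_porbit_mem => /(_ _ _)/eqP <-; try lia.
  by rewrite eq_porbit_mem mem_porbit1.
apply: nat_fun_inj => i iN.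
by rewrite (fund_word_word_uniq (nat_fun_perm _) Ps F' F).
Qed.

(** * Permutations moving zero *)

(* [N 0 1 .. k-1 k+1 .. N-1 k] *)
Definition drop_last N k i :=
  if i == 0 then N else if i <= k then i.-1 else if i == N then k else i.

(* [1 2 .. N 0] *)
Definition rot_up N i := if i == N then 0 else i.+1.

(* The word surviving only for [n = 4]. *)
Definition sporadic i := nth 0 [:: 2; 3; 1; 0] i.

Section Necessity.
(** These stand for [pi], [theta pi] and [theta (theta pi)]; [r] and [q] are the positions of [N] in
    [s] and [t]. *)
Variables (N : nat) (p s t : nat -> nat) (r q : nat).
Hypotheses (Pp : nat_perm N p) (Ps : nat_perm N s) (Pt : nat_perm N t).
Hypotheses (Fs : fund_word N p s r) (Ft : fund_word N s t q).
Hypotheses (avp : av213 N p) (avs : av213 N s) (avt : av213 N t).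
Hypothesis p0 : p 0 <> 0.

Let pos_N : 0 < N.
Proof. by case: Pp => pN _ _; case: (posnP N) => // N0; have := pN 0; lia. Qed.

Let next_t i : i < N -> q <= i -> t i.+1 = s (t i).
Proof. by case: Ft => [_ _ _ nx _] iN qi; exact: nx. Qed.

Let last_t : s (t N) = N. Proof. by case: Ft. Qed.

Let next_s i : i < N -> r <= i -> s i.+1 = p (s i).
Proof. by case: Fs => [_ _ _ nx _] iN ri; exact: nx. Qed.

Let last_s : p (s N) = N. Proof. by case: Fs. Qed.

Let s_le i : i <= N -> s i <= N. Proof. by case: Ps => + _ _; exact. Qed.
Let p_le i : i <= N -> p i <= N. Proof. by case: Pp => + _ _; exact. Qed.
Let s_inj i j : i <= N -> j <= N -> s i = s j -> i = j.
Proof. by case: Ps => _ + _; exact. Qed.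
Let p_inj i j : i <= N -> j <= N -> p i = p j -> i = j.
Proof. by case: Pp => _ + _; exact. Qed.
Let t_inj i j : i <= N -> j <= N -> t i = t j -> i = j.
Proof. by case: Pt => _ + _; exact. Qed.
Let s_surj y : y <= N -> exists2 x, x <= N & s x = y.
Proof. by case: Ps => _ _; exact. Qed.
Let p_surj y : y <= N -> exists2 x, x <= N & p x = y.
Proof. by case: Pp => _ _; exact. Qed.
Let t_surj y : y <= N -> exists2 x, x <= N & t x = y.
Proof. by case: Pt => _ _; exact. Qed.

(** The value [N] of [p] stands at position [s N], and a descent to its left would complete to a
    213. *)
Let incr_before_last i j : i < j -> j < s N -> p i < p j.
Proof.
move=> ij jl; have lN := s_le (leqnn N).
case: (ltngtP (p i) (p j)) => // [lt|/p_inj e].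
  have := @avp i j (s N) ij jl lN lt; rewrite last_s.
  have := @p_le i; have := @p_inj i (s N); rewrite last_s; lia.
by have := e; lia.
Qed.

Let q_lt : s N <> N -> q < N.
Proof.
move=> sN; case: Ft => [[qN tq] _ _ _ _].
case: (eqVneq q N) => [e|]; last lia.
by move: last_t; rewrite -{1}e tq; lia.
Qed.

(** A moved point lies in the cycle part of [t], followed there by its image; such adjacent pairs
    supply the last two letters of 213 patterns in [t]. *)
Let moved x : x <= N -> s x <> x -> s x <> N ->
  exists j, [/\ q <= j, j < N, t j = x & t j.+1 = s x].
Proof.
move=> xN sx sxN; have [j jN tj] := t_surj xN.
exists j; case: (ltnP j q) => qj.
  by case: Ft => [_ _ fx _ _]; have := fx j qj; rewrite tj; lia.
have jN' : j < N.
  by case: (eqVneq j N) => [e|]; last lia; move: last_t; rewrite -e tj; lia.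
by split => //; rewrite next_t // tj.
Qed.

Let no_fixed : r = 0 ->
  exists2 k, k < N & forall i, i <= N -> s i = drop_last N k i.
Proof.
move=> r0; have s0 : s 0 = N by case: Fs => [[_ sr] _ _ _ _]; rewrite -r0.
have lt_l : s N < N.
  have := s_le (leqnn N); have := @s_inj 0 N; rewrite s0; lia.
exists (s N) => //; set l := s N in lt_l *.
have nx i : i < N -> s i.+1 = p (s i) by move=> iN; apply: next_s; lia.
(* Otherwise 0 occurs later, at [j]. Avoidance in [s] makes its successor [p 0] smaller than
   [s 1 = p N], so [p] has the pattern [p 0, 0, p N], with 0 at the predecessor of 0 in [s]. *)
have s1 : 0 < l -> s 1 = 0.
  move=> l0; case: (eqVneq (s 1) 0) => // /eqP ne.
  have [j jN sj] := s_surj (leq0n N).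
  have j0 : j <> 0 by move=> e; move: sj; rewrite e s0; lia.
  have j1 : j <> 1 by move=> e; move: ne; rewrite -e sj.
  have jN' : j <> N by move=> e; move: l0; rewrite /l -e sj.
  have lt1 : s j.+1 < s 1.
    case: (ltngtP (s j.+1) (s 1)) => // [lt|/s_inj e]; last by have := e; lia.
    by case: (@avs 1 j j.+1) => //; rewrite ?sj; lia.
  have Ep0 : p 0 = s j.+1 by rewrite nx ?sj //; lia.
  have EpN : p N = s 1 by rewrite nx ?s0.
  case: j jN sj j0 j1 jN' lt1 Ep0 => // j jN sj _ j1 jN' lt1 Ep0.
  have Epy : p (s j) = 0 by rewrite -nx // sj.
  have y0 : s j <> 0 by move=> e; apply: p0; rewrite -{1}e.
  have yN : s j <> N.
    by move=> e; have := @s_inj j 0; rewrite s0 e; lia.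
  have yle := @s_le j.
  case: (@avp 0 (s j) N) => //; rewrite ?Epy ?EpN ?Ep0; lia.
(* If [i.+1] came later, at [j], then [s i.+2 = p i < p i.+1 = s j.+1], and [s i.+2, i.+1, s j.+1]
   would be a 213. *)
have sS i : i < l -> s i.+1 = i.
  elim/ltn_ind: i => -[|i] IH il; first exact: s1.
  case: (eqVneq (s i.+2) i.+1) => // /eqP ne; exfalso.
  have Ei : s i.+1 = i by apply: IH; lia.
  have Epi : p i = s i.+2 by rewrite nx ?Ei //; lia.
  have gt_x : i.+1 < s i.+2.
    case: (ltngtP i.+1 (s i.+2)) => // [lt|]; last lia.
    have e := IH (s i.+2) lt (ltn_trans lt il).
    by have := @s_inj (s i.+2).+1 i.+2; rewrite e; lia.
  have [j jN sj] : exists2 x, x <= N & s x = i.+1 by apply: s_surj; lia.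
  have jge : i.+2 < j.
    rewrite ltnNge; apply/negP => jle.
    case: j jN sj jle => [|j] jN sj jle; first by move: sj; rewrite s0; lia.
    case: (ltngtP j i.+1) => jc; last by move: sj ne; rewrite jc.
      by have := IH j jc; rewrite sj; lia.
    by lia.
  have jN' : j < N.
    by case: (ltngtP j N) => // e; [lia | move: sj; rewrite e -/l; lia].
  have pinc : p i < p i.+1 by apply: incr_before_last; rewrite -/l; lia.
  case: (@avs i.+2 j j.+1) => //; first by rewrite sj.
  by rewrite (nx j) // sj -Epi.
have [[qN tq] _ fxt _ _] := Ft.
have qN' : q < N by apply: q_lt; rewrite -/l; lia.
(* The cycle part of [t] is [N, l, l-1, .., 0]. *)
have tE i : i <= l -> q + i.+1 <= N /\ t (q + i.+1) = l - i.
  elim: i => [|i IH] il.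
    split; first lia.
    by rewrite addn1 next_t // tq subn0.
  have [le e] := IH (ltnW il).
  have lt : q + i.+1 < N.
    case: (ltngtP (q + i.+1) N) => // eN; first lia.
    have := last_t; rewrite -{1}eN e.
    by have := sS (l - i).-1; rewrite prednK; lia.
  split; first lia.
  rewrite addnS next_t // ?e; last lia.
  by have := sS (l - i).-1; rewrite prednK; lia.
have [le e] := tE l (leqnn l); rewrite subnn in e.
(* Since [s 0 = N], the cycle closes after 0, so all letters strictly between [l] and [N] are fixed
   by [s]. *)
have Eq : q + l.+1 = N.
  case: (ltngtP (q + l.+1) N) => // lt; first last; first lia.
  have := @t_inj (q + l.+1).+1 q; rewrite next_t ?e ?s0 ?tq; lia.
move=> i iN; rewrite /drop_last.
case: eqP => [-> //|i0]; case: leqP => il.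
  by case: i iN i0 il => // i iN _ il; rewrite sS.
case: eqP => [-> //|ne].
have [j jN tj] := t_surj iN.
case: (ltngtP j q) => jq; first by rewrite -tj fxt.
  have /tE [_] : (j - q).-1 <= l by lia.
  have -> : q + (j - q).-1.+1 = j by lia.
  by rewrite tj; lia.
by move: tj; rewrite jq tq; lia.
Qed.

Let some_fixed : 0 < r ->
  (forall i, i <= N -> s i = rot_up N i) \/
  (N = 3 /\ forall i, i <= N -> s i = sporadic i).
Proof.
move=> rpos; have [[rN sr] incr fxs _ _] := Fs.
have [j0 j0N sj0] := s_surj (leq0n N).
have rj0 : r < j0.
  case: (ltngtP r j0) => // [lt|e]; last by move: sr; rewrite e sj0; lia.
  by have := fxs j0 lt; rewrite sj0.
(* The smallest fixed point of [p]. *)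
set c := s 0.
have pc : p c = c by exact: fxs.
have c_lt : c < N by rewrite -sr; apply: incr.
set l := s N.
have l_ne : l <> N by move=> e; have := @s_inj N r; rewrite -/l e sr; lia.
have l_le : l <= N by exact: s_le.
have p_gt i : i < l -> i < p i.
  elim: i => [|i IH] il; first lia.
  by have := IH (ltnW il); have := incr_before_last (ltnSn i) il; lia.
have lc : l < c.
  case: (ltngtP c l) => // [lt|e]; first by have := p_gt c lt; rewrite pc; lia.
  by have := last_s; rewrite -/l -e pc; lia.
have EpN : p N = s r.+1 by rewrite next_s ?sr //; lia.
(* Otherwise avoidance forces [p j > c] for all [j > c], and the cycle through [N] would never come
   down to 0. *)
have vc : p N < c.
  rewrite ltnNge; apply/negP => le.
  have {}le : c < p N.
    by move: (@p_inj N c); rewrite pc; lia.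
  have big j : c < j -> j <= N -> c < p j.
    move=> cj jN; case: (eqVneq j N) => [-> //|ne].
    case: (ltngtP c (p j)) => // [lt|e].
      by case: (@avp c j N) => //; rewrite ?pc; lia.
    by have := @p_inj j c; rewrite pc; lia.
  have : forall i, r + i <= N -> c < s (r + i).
    elim=> [|i IH] iN; first by rewrite addn0 sr.
    rewrite addnS next_s; try lia.
    by apply: big; [apply: IH | apply: s_le]; lia.
  by move/(_ (j0 - r)); rewrite subnKC ?sj0; lia.
(* A letter above [c] here would form a 213 with [s 0 = c] and [s r.+1 = p N]. *)
have w_lt k : r < k -> k <= N -> s k < c.
  move=> rk kN; case: (eqVneq k r.+1) => [->|ne]; first by rewrite -EpN.
  case: (ltngtP (s k) c) => // [lt|e];
    last by have := @s_inj k 0; rewrite -/c e; lia.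
  by case: (@avs 0 r.+1 k) => //; [lia | rewrite -EpN].
(* All letters from [c] up now lie among the first [r + 1], which increase from [c]. *)
have sE i : i <= r -> s i = c + i.
  elim/ltn_ind: i => i IH ir.
  case: (posnP i) => [->|i0]; first by rewrite addn0.
  have prev : c + i.-1 < s i.
    by rewrite -IH; [apply: incr; lia | lia | lia].
  case: (eqVneq (s i) (c + i)) => // ne.
  have [j jN sj] : exists2 x, x <= N & s x = c + i.
    by apply: s_surj; have := s_le (leq_trans ir rN); lia.
  case: (ltnP r j) => rj; first by have := w_lt j rj jN; lia.
  case: (ltngtP j i) => ji.
  - by have := IH j ji rj; lia.
  - by have := incr i j ji rj; lia.
  - by move: sj ne; rewrite ji; lia.
have Nr : N = c + r by rewrite -sE.
have p_mid x : c <= x -> x < N -> p x = x.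
  move=> cx xN; have -> : x = s (x - c) by rewrite sE; lia.
  by apply: fxs; lia.
have [y yN py] := p_surj (leq0n N).
have [[qN tq] _ fxt _ _] := Ft.
have qN' : q < N by apply: q_lt.
have tq1 : t q.+1 = l by rewrite next_t // tq.
(* If [y = N], then [l = 0] gives [rot_up], and [l > 0] gives the pattern [l, 0, c] in [t]. *)
case: (eqVneq y N) => [yE|yN'].
  rewrite yE in py.
  have sr1 : s r.+1 = 0 by rewrite -EpN.
  case: (posnP l) => l0.
    left.
    have rN1 : r.+1 = N by apply: s_inj; rewrite ?sr1 //; lia.
    move=> i iN; rewrite /rot_up; case: eqP => [-> //|ne].
    by rewrite sE; lia.
  exfalso.
  have [j [qj jN tj tj1]] :
      exists j, [/\ q <= j, j < N, t j = 0 & t j.+1 = s 0].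
    by apply: moved => //; rewrite -/c; lia.
  have jq : j <> q by move=> e; move: tj; rewrite e tq; lia.
  have jq1 : j <> q.+1 by move=> e; move: tj; rewrite e tq1; lia.
  by case: (@avt q.+1 j j.+1) => //; rewrite ?tq1 ?tj ?tj1 //; lia.
have yc : y < c.
  by rewrite ltnNge; apply/negP => cy; have := p_mid y cy; rewrite py; lia.
(* If [p i < c], then [p i, 0, c] is a 213 in [p]; if [c <= p i < N], then [p i] is a fixed point,
   which forces [p i = i < c]. By injectivity at most one [i] lies below [y]. *)
have before i : i < y -> p i = N.
  move=> iy; case: (eqVneq (p i) N) => // ne.
  have piN : p i <= N by apply: p_le; lia.
  case: (ltnP (p i) c) => pic.
    case: (@avp i y c) => //; rewrite ?py ?pc //; try lia.
    by case: (posnP (p i)) => // e; have := @p_inj i y; rewrite e py; lia.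
  have /p_inj e : p (p i) = p i by apply: p_mid; lia.
  by have := e; lia.
have y0 : y <> 0 by move=> e; apply: p0; rewrite -{1}e.
have y1 : y = 1.
  case: (ltngtP y 1) => // yy; first lia.
  by have := @p_inj 0 1; rewrite !before; lia.
have Ep0 : p 0 = N by apply: before; lia.
rewrite y1 in py yc.
have l0 : l = 0 by apply: p_inj; rewrite // Ep0 last_s.
rewrite l0 in tq1.
have q1N : q.+1 < N.
  case: (ltngtP q.+1 N) => // e; first lia.
  by move: last_t; rewrite -{1}e tq1 -/c; lia.
have tq2 : t q.+2 = c by rewrite next_t // tq1.
have s1 : s 1 = c.+1 by rewrite sE //; lia.
(* The cycle part of [t] begins [N, 0, c]; unless [c.+1 = N], the later adjacent letters [1, c.+1]
   complete [c] to a 213. *)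
case: (eqVneq c.+1 N) => cN; last first.
  exfalso.
  have [j [qj jN tj tj1]] :
      exists j, [/\ q <= j, j < N, t j = 1 & t j.+1 = s 1].
    by apply: moved; rewrite ?s1; lia.
  have jq : j <> q by move=> e; move: tj; rewrite e tq; lia.
  have jq1 : j <> q.+1 by move=> e; move: tj; rewrite e tq1; lia.
  have jq2 : j <> q.+2 by move=> e; move: tj; rewrite e tq2; lia.
  by case: (@avt q.+2 j j.+1) => //; rewrite ?tq2 ?tj ?tj1 ?s1 //; lia.
have r1 : r = 1 by lia.
have sc : s c = 1.
  apply: p_inj; rewrite ?py; try (by lia); first by apply: s_le; lia.
  by rewrite -next_s; [rewrite cN -/l l0 | lia | lia].
have q2N : q.+2 < N.
  case: (ltngtP q.+2 N) => // e; first lia.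
  by move: last_t; rewrite -{1}e tq2; lia.
have tq3 : t q.+3 = 1 by rewrite next_t ?tq2 //; lia.
have q3N : q.+3 = N.
  case: (ltngtP q.+3 N) => // lt; last lia.
  have := @t_inj q.+4 q; rewrite next_t ?tq3 ?s1 ?cN ?tq; lia.
right; case: (eqVneq N 3) => [N3|N3].
  split=> // -[|[|[|[|i]]]] iN; rewrite /sporadic /=; try lia.
  - by rewrite -sc; congr s; lia.
  - by rewrite -l0 /l; congr s; lia.
(* The cycle part of [t] is [N, 0, c, 1]. For [N > 3] the letter 2 lies before it, and [2, 0, c] is
   a 213. *)
exfalso.
have [j jN tj] : exists2 x, x <= N & t x = 2 by apply: t_surj; lia.
have jq : j < q.
  rewrite ltnNge; apply/negP => qj.
  have : [|| j == q, j == q.+1, j == q.+2 | j == q.+3] by lia.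
  case/or4P => /eqP e; move: tj; rewrite e ?tq ?tq1 ?tq2 ?tq3; lia.
by case: (@avt j q.+1 q.+2) => //; rewrite ?tj ?tq1 ?tq2 //; lia.
Qed.

Lemma theta_moving_zero :
  [\/ exists2 k, k < N & forall i, i <= N -> s i = drop_last N k i,
      forall i, i <= N -> s i = rot_up N i |
      N = 3 /\ forall i, i <= N -> s i = sporadic i].
Proof.
case: (posnP r) => [/no_fixed ?|/some_fixed [?|?]].
- exact: Or31.
- exact: Or32.
- exact: Or33.
Qed.

End Necessity.

(** * The surviving permutations and their number *)

(* The identity if [f] does not permute [0 .. N]. *)
Definition perm_of_fun N (f : nat -> nat) : 'S_N.+1 :=
  odflt 1%g [pick s : 'S_N.+1 | [forall i : 'I_N.+1, s i == f i :> nat]].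

Lemma perm_of_funE N f :
  (forall i, i <= N -> f i <= N) ->
  (forall i j, i <= N -> j <= N -> f i = f j -> i = j) ->
  forall i, i <= N -> nat_fun (perm_of_fun N f) i = f i.
Proof.
move=> fN fI i iN; rewrite /perm_of_fun.
case: pickP => [s /forallP H|no].
  by rewrite /nat_fun (eqP (H _)) inordK.
have gI : injective (fun i : 'I_N.+1 => inord (f i) : 'I_N.+1).
  move=> x y; have xN := ltn_ord x; have yN := ltn_ord y.
  move=> /(congr1 val); rewrite /= !inordK ?ltnS ?fN //.
  by move/fI => e; apply/val_inj/e.
have /forallP[] := no (perm gI).
by move=> x; rewrite permE inordK // ltnS fN //; have := ltn_ord x.
Qed.

(** The functions compared agree only on [0 .. N], so each notion is transported along equality on
    that range. *)
Lemma eq_nat_perm N f g :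
  (forall i, i <= N -> f i = g i) -> nat_perm N f -> nat_perm N g.
Proof.
move=> e [fN fI fS]; split.
- by move=> i iN; rewrite -e // fN.
- by move=> i j iN jN; rewrite -!e //; exact: fI.
- by move=> y /fS[x xN <-]; exists x; rewrite -?e.
Qed.

Lemma nat_perm_of_inj N f :
  (forall i, i <= N -> f i <= N) ->
  (forall i j, i <= N -> j <= N -> f i = f j -> i = j) -> nat_perm N f.
Proof.
move=> fN fI; apply: eq_nat_perm (nat_fun_perm (perm_of_fun N f)).
exact: perm_of_funE.
Qed.

Lemma eq_av213 N f g :
  (forall i, i <= N -> f i = g i) -> av213 N f -> av213 N g.
Proof.
move=> e H i j k ij jk kN; rewrite -!e; try lia; exact: H.
Qed.

Lemma eq_fund_word N p s r p' s' : nat_perm N s ->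
  (forall i, i <= N -> p i = p' i) -> (forall i, i <= N -> s i = s' i) ->
  fund_word N p s r -> fund_word N p' s' r.
Proof.
move=> [sN _ _] ep es [[rN sr] inc fx nx la]; split.
- by split => //; rewrite -es.
- by move=> i j ij jr; rewrite -!es; [exact: inc | lia | lia].
- by move=> i ir; rewrite -es -?ep; [exact: fx | apply: sN; lia | lia].
- move=> j rj jN; rewrite -!es -?ep; try lia; first exact: nx.
  by apply: sN; lia.
- by rewrite -es -?ep //; exact: sN.
Qed.

(* [s] and [t] play the roles of [theta pi] and [theta (theta pi)]. *)
Definition good N (p : nat -> nat) : Prop :=
  exists s t r q, [/\ nat_perm N s /\ nat_perm N t,
    fund_word N p s r /\ fund_word N s t q, av213 N p, av213 N s & av213 N t].

Definition good_perms N : {set 'S_N.+1} :=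
  [set pi | [&& avoids pi [:: 2; 1; 3], avoids (theta pi) [:: 2; 1; 3] &
                avoids (theta (theta pi)) [:: 2; 1; 3]]].

(** Replaces the computation of [theta] by exhibited words: avoidance provides them, and conversely
    they determine both images. *)
Lemma good_permsP N (pi : 'S_N.+1) :
  reflect (good N (nat_fun pi)) (pi \in good_perms N).
Proof.
rewrite inE; apply: (iffP and3P) => [[/avoids213P a1 a2 a3]|].
  have [r F1] := avoids_theta_fund_word a2.
  have [q F2] := avoids_theta_fund_word a3.
  exists (nat_fun (theta pi)), (nat_fun (theta (theta pi))), r, q.
  split=> //; [split; exact: nat_fun_perm | exact/avoids213P
    | exact/avoids213P].
case=> s [t [r [q [[Ps Pt] [F1 F2] a1 a2 a3]]]].
have [sN sI _] := Ps; have [tN tI _] := Pt.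
have es := perm_of_funE sN sI; have et := perm_of_funE tN tI.
have es' i : i <= N -> s i = nat_fun (perm_of_fun N s) i by move/es.
have et' i : i <= N -> t i = nat_fun (perm_of_fun N t) i by move/et.
have E1 : theta pi = perm_of_fun N s.
  by apply: fund_word_theta; apply: eq_fund_word F1.
have E2 : theta (theta pi) = perm_of_fun N t.
  by rewrite E1; apply: fund_word_theta; apply: eq_fund_word F2.
split; apply/avoids213P => //; rewrite ?E2 ?E1.
  exact: eq_av213 a2.
exact: eq_av213 a3.
Qed.

Lemma eq_good N p p' :
  (forall i, i <= N -> p i = p' i) -> good N p -> good N p'.
Proof.
move=> e [s [t [r [q [[Ps Pt] [F1 F2] a1 a2 a3]]]]].
exists s, t, r, q; split => //; last exact: eq_av213 a1.
by split => //; apply: eq_fund_word F1.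
Qed.

(* The cyclic permutation [(N 0 1 .. k-1 k+1 .. N-1 k)]. *)
Definition drop_last_cycle N k x :=
  if x == k then N else if x == N then drop_last N k 1
  else if x < k then drop_last N k x.+2 else drop_last N k x.+1.

(* [k+1 .. N-1 N k k-1 .. 1 0] *)
Definition rise_fall N k i := if i < N - k then k.+1 + i else N - i.

(** [theta] exchanges this word and [sporadic]. *)
Definition sporadic_pre i := nth 0 [:: 3; 0; 2; 1] i.

(** These views present the value of a word as a few linear cases, ready for [lia]. *)
Variant drop_last_spec N k i : nat -> Prop :=
  | DropLastFirst of i = 0 : drop_last_spec N k i N
  | DropLastLow of 0 < i & i <= k : drop_last_spec N k i i.-1
  | DropLastEnd of i = N : drop_last_spec N k i k
  | DropLastHigh of k < i & i < N : drop_last_spec N k i i.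

Lemma drop_lastP N k i : k < N -> i <= N ->
  drop_last_spec N k i (drop_last N k i).
Proof.
rewrite /drop_last => kN iN; case: (eqVneq i 0) => i0; first by constructor.
case: (leqP i k) => ik; first by constructor; lia.
by case: (eqVneq i N) => iN'; constructor; lia.
Qed.

(** Beyond the generic cases, the skipped letter [k] may be 0 or [N - 1], and [N] may be 1. *)
Variant drop_last_cycle_spec N k x : nat -> Prop :=
  | CycleEnd of x = k : drop_last_cycle_spec N k x N
  | CycleFirst of x = N & 0 < k : drop_last_cycle_spec N k x 0
  | CycleFirst0 of x = N & k = 0 & 1 < N : drop_last_cycle_spec N k x 1
  | CycleSmall of x = N & N = 1 : drop_last_cycle_spec N k x 0
  | CycleLow of x.+1 < k : drop_last_cycle_spec N k x x.+1
  | CycleJumpEnd of x.+1 = k & k.+1 = N : drop_last_cycle_spec N k x k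
  | CycleJump of x.+1 = k & k.+1 < N : drop_last_cycle_spec N k x k.+1
  | CycleHighEnd of k < x & x.+1 = N : drop_last_cycle_spec N k x k
  | CycleHigh of k < x & x.+1 < N : drop_last_cycle_spec N k x x.+1.

Lemma drop_last_cycleP N k x : k < N -> x <= N ->
  drop_last_cycle_spec N k x (drop_last_cycle N k x).
Proof.
move=> kN xN; rewrite /drop_last_cycle.
case: (eqVneq x k) => xk; first by constructor.
case: (eqVneq x N) => xN'.
  case: (@drop_lastP N k 1) => // [||N1|] *; try lia.
  - by constructor 2; lia.
  - have k0 : k = 0 by lia.
    by rewrite k0; constructor 4; lia.
  - by constructor 3; lia.
case: (ltnP x k) => xlt.
  case: (@drop_lastP N k x.+2) => //= *; try lia.
  - by constructor 5.
  - by constructor 6; lia.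
  - have -> : x.+2 = k.+1 by lia.
    by constructor 7; lia.
case: (@drop_lastP N k x.+1) => //= *; try lia.
- by constructor 8; lia.
- by constructor 9; lia.
Qed.

Variant rise_fall_spec N k i : nat -> Prop :=
  | Rise of i < N - k : rise_fall_spec N k i (k.+1 + i)
  | Fall of N - k <= i : rise_fall_spec N k i (N - i).

Lemma rise_fallP N k i : rise_fall_spec N k i (rise_fall N k i).
Proof. by rewrite /rise_fall; case: ltnP => ?; constructor. Qed.

Variant rot_up_spec N i : nat -> Prop :=
  | RotEnd of i = N : rot_up_spec N i 0
  | RotNext of i <> N : rot_up_spec N i i.+1.

Lemma rot_upP N i : rot_up_spec N i (rot_up N i).
Proof. by rewrite /rot_up; case: eqP => ?; constructor. Qed.

(** Opens one value at a time and prunes with [lia] after each, which keeps the case tree small. *)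
Ltac words := repeat (match goal with
  | |- context [drop_last ?N ?k ?i] =>
      destruct (@drop_lastP N k i ltac:(lia) ltac:(lia))
  | |- context [drop_last_cycle ?N ?k ?i] =>
      destruct (@drop_last_cycleP N k i ltac:(lia) ltac:(lia))
  | |- context [rise_fall ?N ?k ?i] => destruct (rise_fallP N k i)
  | |- context [rot_up ?N ?i] => destruct (rot_upP N i)
  end; try by lia); try by lia.

Lemma drop_last_perm N k : k < N -> nat_perm N (drop_last N k).
Proof. by move=> kN; apply: nat_perm_of_inj => [i iN|i j iN jN]; words. Qed.

Lemma drop_last_cycle_perm N k : k < N -> nat_perm N (drop_last_cycle N k).
Proof. by move=> kN; apply: nat_perm_of_inj => [i iN|i j iN jN]; words. Qed.

Lemma rise_fall_perm N k : k < N -> nat_perm N (rise_fall N k).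
Proof. by move=> kN; apply: nat_perm_of_inj => [i iN|i j iN jN]; words. Qed.

Lemma rot_up_perm N : nat_perm N (rot_up N).
Proof. by apply: nat_perm_of_inj => [i iN|i j iN jN]; words. Qed.

Lemma fund_word_drop_last N k : k < N ->
  fund_word N (drop_last_cycle N k) (drop_last N k) 0.
Proof.
by move=> kN; split => [|i j ij jr|i ir|j rj jN|];
  [split => // | lia | lia | |]; words.
Qed.

(** The fixed points below [N] are [k+1 .. N-1], and the cycle runs [N, k, k-1, .., 0]. *)
Lemma fund_word_rise_fall N k : k < N ->
  fund_word N (drop_last N k) (rise_fall N k) (N - k.+1).
Proof.
by move=> kN; split => [|i j ij jr|i ir|j rj jN|];
  [split; first by lia | | | |]; words.
Qed.

(** [drop_last N 0] is the transposition of 0 and [N]. *)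
Lemma fund_word_rot_up N : 0 < N -> fund_word N (drop_last N 0) (rot_up N) N.-1.
Proof.
by move=> N0; split => [|i j ij jr|i ir|j rj jN|];
  [split; first by lia | | | |]; words.
Qed.

(** [rot_up N] is a full cycle, which reads [N 0 1 .. N-1] from [N] on. *)
Lemma fund_word_rot_down N : 0 < N ->
  fund_word N (rot_up N) (drop_last N N.-1) 0.
Proof.
by move=> N0; split => [|i j ij jr|i ir|j rj jN|];
  [split => // | lia | lia | |]; words.
Qed.

Lemma av213_drop_last N k : k < N -> av213 N (drop_last N k).
Proof. by move=> kN a b c ab bc cN; words. Qed.

Lemma av213_drop_last_cycle N k : k < N -> av213 N (drop_last_cycle N k).
Proof. by move=> kN a b c ab bc cN; words. Qed.

Lemma av213_rise_fall N k : k < N -> av213 N (rise_fall N k).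
Proof. by move=> kN a b c ab bc cN; words. Qed.

Lemma av213_rot_up N : av213 N (rot_up N).
Proof. by move=> a b c ab bc cN; words. Qed.

Lemma good_drop_last_cycle N k : k < N -> good N (drop_last_cycle N k).
Proof.
move=> kN; exists (drop_last N k), (rise_fall N k), 0, (N - k.+1).
split; first by split; [exact: drop_last_perm | exact: rise_fall_perm].
- by split; [exact: fund_word_drop_last | exact: fund_word_rise_fall].
- exact: av213_drop_last_cycle.
- exact: av213_drop_last.
- exact: av213_rise_fall.
Qed.

Lemma good_drop_last0 N : 0 < N -> good N (drop_last N 0).
Proof.
move=> N0; have N1 : N.-1 < N by lia.
exists (rot_up N), (drop_last N N.-1), N.-1, 0.
split; first by split; [exact: rot_up_perm | exact: drop_last_perm].
- by split; [exact: fund_word_rot_up | exact: fund_word_rot_down].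
- exact: av213_drop_last.
- exact: av213_rot_up.
- exact: av213_drop_last.
Qed.

Ltac small_words :=
  repeat match goal with
  | |- context [nth 0 _ ?i] => is_var i; case: i => [|[|[|[|?]]]] //=
  end; lia.

Lemma sporadic_perm : nat_perm 3 sporadic.
Proof.
by apply: nat_perm_of_inj => [i|i j]; rewrite /sporadic; small_words.
Qed.

Lemma sporadic_pre_perm : nat_perm 3 sporadic_pre.
Proof.
by apply: nat_perm_of_inj => [i|i j]; rewrite /sporadic_pre; small_words.
Qed.

Lemma fund_word_sporadic : fund_word 3 sporadic_pre sporadic 1.
Proof.
by split => [|i j|i|j|] //; rewrite /sporadic /sporadic_pre; small_words.
Qed.

Lemma good_sporadic_pre : good 3 sporadic_pre.
Proof.
exists sporadic, sporadic_pre, 1, 0.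
split; first by split; [exact: sporadic_perm | exact: sporadic_pre_perm].
- split; first exact: fund_word_sporadic.
  by split => [|i j|i|j|] //; rewrite /sporadic /sporadic_pre; small_words.
- by move=> a b c; rewrite /sporadic_pre; small_words.
- by move=> a b c; rewrite /sporadic; small_words.
- by move=> a b c; rewrite /sporadic_pre; small_words.
Qed.

(* Index [k = N] stands for the permutation that [theta] maps to [rot_up N]. *)
Definition moving_zero N k :=
  if k < N then drop_last_cycle N k else drop_last N 0.

Lemma moving_zero_perm N k : 0 < N -> nat_perm N (moving_zero N k).
Proof.
move=> N0; rewrite /moving_zero; case: (ltnP k N) => kN.
  exact: drop_last_cycle_perm.
exact: drop_last_perm.
Qed.

Lemma good_moving_zero N k : 0 < N -> good N (moving_zero N k).
Proof.
move=> N0; rewrite /moving_zero; case: (ltnP k N) => kN.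
  exact: good_drop_last_cycle.
exact: good_drop_last0.
Qed.

Lemma moving_zero_neq0 N k : 0 < N -> moving_zero N k 0 <> 0.
Proof.
by move=> N0; rewrite /moving_zero; case: (ltnP k N) => kN; words.
Qed.

(** For [k < N] the point sent to [N] is [k]. Index [N] sends 0 to [N], as index 0 does, but these
    two differ at [N], with values 0 and 1 once [1 < N]. *)
Lemma moving_zero_inj N k k' : 1 < N -> k <= N -> k' <= N ->
  (forall i, i <= N -> moving_zero N k i = moving_zero N k' i) -> k = k'.
Proof.
move=> N1 kN k'N H.
have := H k kN; have := H k' k'N; have := H 0 (leq0n N); have := H N (leqnn N).
rewrite /moving_zero; case: (ltnP k N) => ?; case: (ltnP k' N) => ?; words.
Qed.

Lemma sporadic_pre_neq k : k <= 3 ->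
  ~ (forall i, i <= 3 -> sporadic_pre i = moving_zero 3 k i).
Proof.
by case: k => [|[|[|[|k]]]] // _ H; have := H 0 isT; have := H 1 isT.
Qed.

(** * Classification and count of the good permutations moving zero *)

(** [theta_moving_zero] lists the possible words [s], and each word determines [p]. *)
Lemma good_classify N p : nat_perm N p -> good N p -> p 0 <> 0 ->
  (exists2 k, k <= N & forall i, i <= N -> p i = moving_zero N k i) \/
  (N = 3 /\ forall i, i <= N -> p i = sporadic_pre i).
Proof.
move=> Pp [s [t [r [q [[Ps Pt] [F1 F2] a1 a2 a3]]]]] p0.
have N0 : 0 < N.
  by case: Pp => pN _ _; case: (posnP N) => // N0; have := pN 0; lia.
have ep i : i <= N -> p i = p i by [].
case: (theta_moving_zero Pp Ps Pt F1 F2 a1 a2 a3 p0) => [[k kN e]|e|[N3 e]].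
- left; exists k; first exact: ltnW.
  have F1' := eq_fund_word Ps ep e F1.
  rewrite /moving_zero kN.
  exact: fund_word_perm_uniq (drop_last_perm kN) F1' (fund_word_drop_last kN).
- left; exists N => //.
  have F1' := eq_fund_word Ps ep e F1.
  rewrite /moving_zero ltnn.
  exact: fund_word_perm_uniq (rot_up_perm N) F1' (fund_word_rot_up N0).
- right; split => //; move: e ep Ps F1; rewrite N3 => e ep Ps F1.
  have F1' := eq_fund_word Ps ep e F1.
  exact: fund_word_perm_uniq sporadic_perm F1' fund_word_sporadic.
Qed.

Lemma perm_of_fun_nat_perm N f : nat_perm N f ->
  forall i, i <= N -> nat_fun (perm_of_fun N f) i = f i.
Proof. by case=> fN fI _; exact: perm_of_funE. Qed.

Lemma eq_perm_of_fun N f (pi : 'S_N.+1) : nat_perm N f ->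
  (forall i, i <= N -> nat_fun pi i = f i) -> pi = perm_of_fun N f.
Proof.
by move=> Pf e; apply: nat_fun_inj => i iN; rewrite e // perm_of_fun_nat_perm.
Qed.

Lemma card_good_moving_zero N : 1 < N ->
  #|[set pi in good_perms N | pi ord0 != ord0]| = N.+1 + (N == 3).
Proof.
move=> N1; have N0 : 0 < N by lia.
pose f (k : 'I_N.+1) := perm_of_fun N (moving_zero N k).
have fE (k : 'I_N.+1) i : i <= N -> nat_fun (f k) i = moving_zero N k i.
  by apply: perm_of_fun_nat_perm; exact: moving_zero_perm.
have f_inj : injective f.
  move=> k k' e; apply/val_inj.
  apply: (moving_zero_inj N1 (leq_ord k) (leq_ord k')) => i iN.
  by rewrite -!fE // e.
have zeroP (pi : 'S_N.+1) : (pi ord0 != ord0) = (nat_fun pi 0 != 0).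
  by rewrite -val_eqE /= -nat_funE.
have goodf k : f k \in [set pi in good_perms N | pi ord0 != ord0].
  rewrite inE zeroP fE //; apply/andP; split; last exact/eqP/moving_zero_neq0.
  apply/good_permsP/(eq_good _ (good_moving_zero k N0)) => i iN.
  by rewrite fE.
have classify pi : pi \in [set pi in good_perms N | pi ord0 != ord0] ->
    pi \in [set f k | k : 'I_N.+1] \/
    N = 3 /\ pi = perm_of_fun N sporadic_pre.
  rewrite inE zeroP => /andP[/good_permsP g /eqP p0].
  case: (good_classify (nat_fun_perm pi) g p0) => [[k kN e]|[N3 e]].
    left; apply/imsetP; exists (inord k) => //.
    rewrite /f inordK //; apply: eq_perm_of_fun => //.
    exact: moving_zero_perm.
  right; split => //; apply: eq_perm_of_fun => //.
  by rewrite N3; exact: sporadic_pre_perm.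
case: (eqVneq N 3) => [N3|N3]; last first.
  rewrite addn0 -[RHS]card_ord -(card_imset _ f_inj).
  apply: eq_card => pi; apply/idP/idP => [/classify[//|[e]]|/imsetP[k _ ->]];
    last exact: goodf.
  by case/eqP: N3.
pose x := perm_of_fun N sporadic_pre.
have xE i : i <= N -> nat_fun x i = sporadic_pre i.
  apply: perm_of_fun_nat_perm.
  by rewrite N3; exact: sporadic_pre_perm.
have -> : [set pi in good_perms N | pi ord0 != ord0]
    = x |: [set f k | k : 'I_N.+1].
  apply/setP => pi; rewrite in_setU1; apply/idP/orP.
    by case/classify => [|[_ ->]]; [right | left].
  case=> [/eqP ->|/imsetP[k _ ->]]; last exact: goodf.
  rewrite inE zeroP xE //; apply/andP; split => //.
  apply/good_permsP.
  have e i : i <= N -> sporadic_pre i = nat_fun x i by move/xE.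
  by apply: (eq_good e); rewrite N3; exact: good_sporadic_pre.
rewrite cardsU1 card_imset // card_ord addnC.
suff -> : x \notin [set f k | k : 'I_N.+1] by [].
apply/imsetP => -[k _ e].
have H i : i <= N -> sporadic_pre i = moving_zero N k i.
  by move=> iN; rewrite -xE // e fE.
move: (nat_of_ord k) (leq_ord k) H; rewrite N3.
exact: sporadic_pre_neq.
Qed.

(** * Permutations fixing zero *)

Definition lift_fun (f : nat -> nat) i := if i is j.+1 then (f j).+1 else 0.
Definition unlift_fun (f : nat -> nat) i := (f i.+1).-1.

Lemma lift_fun_perm N f : nat_perm N f -> nat_perm N.+1 (lift_fun f).
Proof.
case=> fN fI _; apply: nat_perm_of_inj => [[|i] //=|[|i] [|j] //= iN jN [e]].
  exact: fN.
by congr S; exact: fI.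
Qed.

(** A new smallest fixed point is written first, so the word gains a leading 0 and one more fixed
    point. *)
Lemma fund_word_lift N p s r :
  fund_word N p s r -> fund_word N.+1 (lift_fun p) (lift_fun s) r.+1.
Proof.
case=> [[rN sr] inc fx nx la]; split => /=.
- by rewrite sr.
- by move=> [|i] [|j] //= ij jr; exact: inc.
- by move=> [|i] //= ir; rewrite fx.
- by move=> [|j] //= rj jN; rewrite nx.
- by rewrite la.
Qed.

Lemma av213_lift N f : av213 N f -> av213 N.+1 (lift_fun f).
Proof. by move=> H [|i] [|j] [|k] //= ij jk kN; try lia; exact: (H i j k). Qed.

Lemma good_lift N p : good N p -> good N.+1 (lift_fun p).
Proof.
case=> s [t [r [q [[Ps Pt] [F1 F2] a1 a2 a3]]]].
exists (lift_fun s), (lift_fun t), r.+1, q.+1.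
by split; [split; exact: lift_fun_perm | split; exact: fund_word_lift
  | exact: av213_lift | exact: av213_lift | exact: av213_lift].
Qed.

(** The truncated predecessor loses nothing: by injectivity only position 0 has value 0. *)
Lemma unlift_funE N f : nat_perm N.+1 f -> f 0 = 0 ->
  forall i, i <= N -> f i.+1 = (unlift_fun f i).+1.
Proof.
move=> [_ fI _] f0 i iN; rewrite /unlift_fun prednK // lt0n; apply/eqP => e.
by have := @fI i.+1 0; rewrite e f0; lia.
Qed.

Lemma unlift_fun_perm N f : nat_perm N.+1 f -> f 0 = 0 ->
  nat_perm N (unlift_fun f).
Proof.
move=> Pf f0; have E := unlift_funE Pf f0; case: Pf => fN fI _.
apply: nat_perm_of_inj => [i iN|i j iN jN e].
  by have := fN i.+1; rewrite E //; lia.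
by have := @fI i.+1 j.+1; rewrite !E // e; lia.
Qed.

(** The fixed letter 0 lies in the increasing part, hence comes first. Applied twice, this makes
    both images fix 0 as well. *)
Lemma fund_word_zero N p s r : nat_perm N.+1 s -> p 0 = 0 ->
  fund_word N.+1 p s r -> s 0 = 0 /\ 0 < r.
Proof.
move=> Ps p0 F; have fx := fund_word_fixed Ps F.
have [_ sI sS] := Ps; have [j jN sj] := sS 0 (leq0n _).
have jr : j < r by apply/(fx j jN); rewrite sj p0.
split; last lia.
case: F => [_ inc _ _ _]; case: (posnP j) => [e|j0]; first by rewrite e in sj.
by have := inc 0 j j0 (ltnW jr); rewrite sj.
Qed.

Lemma fund_word_unlift N p s r :
  nat_perm N.+1 p -> nat_perm N.+1 s -> p 0 = 0 ->
  fund_word N.+1 p s r -> fund_word N (unlift_fun p) (unlift_fun s) r.-1.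
Proof.
move=> Pp Ps p0 F; have [s0 r0] := fund_word_zero Ps p0 F.
have Ep := unlift_funE Pp p0; have Es := unlift_funE Ps s0.
have [us _ _] := unlift_fun_perm Ps s0.
case: r r0 F => // r _ [[rN sr] inc fx nx la]; split => /=.
- by split => //; have := Es r rN; rewrite sr => -[].
- move=> i j ij jr; have := inc i.+1 j.+1 ij jr.
  by rewrite !Es //; lia.
- move=> i ir; have := fx i.+1 ir; rewrite Es ?Ep; first by case.
    by apply: us; lia.
  by lia.
- move=> j rj jN; have := nx j.+1 rj jN; rewrite !Es ?Ep; try lia.
  by apply: us; lia.
- by move: la; rewrite Es // Ep => [[]|] //; exact: us.
Qed.

Lemma av213_unlift N f : nat_perm N.+1 f -> f 0 = 0 ->
  av213 N.+1 f -> av213 N (unlift_fun f).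
Proof.
move=> Pf f0 H i j k ij jk kN; have E := unlift_funE Pf f0.
have := H i.+1 j.+1 k.+1 ij jk kN; rewrite !E; lia.
Qed.

Lemma good_unlift N p : nat_perm N.+1 p -> p 0 = 0 ->
  good N.+1 p -> good N (unlift_fun p).
Proof.
move=> Pp p0 [s [t [r [q [[Ps Pt] [F1 F2] a1 a2 a3]]]]].
have [s0 _] := fund_word_zero Ps p0 F1; have [t0 _] := fund_word_zero Pt s0 F2.
exists (unlift_fun s), (unlift_fun t), r.-1, q.-1.
by split; [split; exact: unlift_fun_perm | split; exact: fund_word_unlift
  | exact: av213_unlift | exact: av213_unlift | exact: av213_unlift].
Qed.

Lemma card_good_fixing_zero N :
  #|[set pi in good_perms N.+1 | pi ord0 == ord0]| = #|good_perms N|.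
Proof.
pose f (pi : 'S_N.+1) := perm_of_fun N.+1 (lift_fun (nat_fun pi)).
have fE pi i : i <= N.+1 -> nat_fun (f pi) i = lift_fun (nat_fun pi) i.
  by apply: perm_of_fun_nat_perm; exact/lift_fun_perm/nat_fun_perm.
have f_inj : injective f.
  move=> x y e; apply: nat_fun_inj => i iN.
  by have [] : lift_fun (nat_fun x) i.+1 = lift_fun (nat_fun y) i.+1
    by rewrite -!fE // e.
rewrite -(card_imset _ f_inj); apply: eq_card => pi; rewrite inE.
apply/andP/imsetP => [[/good_permsP g /eqP p0]|[x /good_permsP g ->]].
  have n0 : nat_fun pi 0 = 0 by rewrite -[0]/(val (@ord0 N.+1)) nat_funE p0.
  have Pp := nat_fun_perm pi; have Pu := unlift_fun_perm Pp n0.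
  have uE := perm_of_fun_nat_perm Pu.
  exists (perm_of_fun N (unlift_fun (nat_fun pi))).
    apply/good_permsP; apply: (eq_good _ (good_unlift Pp n0 g)) => i iN.
    by rewrite uE.
  apply: nat_fun_inj => -[|i] iN; rewrite fE //= uE //.
  exact: unlift_funE Pp n0 _ iN.
split.
  by apply/good_permsP; apply: (eq_good _ (good_lift g)) => i iN; rewrite fE.
by rewrite -val_eqE /= -nat_funE fE.
Qed.

(** * The count by induction *)

Lemma card_good_perms1 : #|good_perms 1| = 2.
Proof.
have -> : good_perms 1 = setT.
  apply/setP => pi; rewrite !inE.
  by apply/and3P; split; apply/avoids213P => i j k; lia.
by rewrite cardsT card_Sn.
Qed.

(** The summand [(N < 3)] records the deficit of one at [n = 2] and [n = 3], which the sporadic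
    permutation cancels at [n = 4]. *)
Lemma card_good_perms N : 0 < N -> #|good_perms N| + (N < 3) = 'C(N.+2, 2).
Proof.
case: N => // N _; elim: N => [|N IH]; first by rewrite card_good_perms1.
(* Pascal's rule adds [N.+3], the size of the family [moving_zero N.+2]. *)
rewrite binS bin1 -IH.
have := card_good_fixing_zero N.+1; have := @card_good_moving_zero N.+2 isT.
rewrite -(cardsID [set pi : 'S_N.+3 | pi ord0 == ord0] (good_perms N.+2)).
set a := #|[set pi in _ | _ != _]|; set b := #|[set pi in _ | _]|.
have -> : #|good_perms N.+2 :&: [set pi : 'S_N.+3 | pi ord0 == ord0]| = b.
  by apply: eq_card => pi; rewrite !inE.
have -> : #|good_perms N.+2 :\: [set pi : 'S_N.+3 | pi ord0 == ord0]| = a.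
  by apply: eq_card => pi; rewrite !inE andbC.
move=> -> ->; lia.
Qed.

Theorem theorem4p1 (n : nat) (hn : 4 <= n) :
  #|[set pi : 'S_n | [&& avoids pi [:: 2; 1; 3],
                         avoids (theta pi) [:: 2; 1; 3] &
                         avoids (iter 2 (@theta n) pi) [:: 2; 1; 3]]]|
  = 'C(n.+1, 2).
Proof.
case: n hn => // N hn; have := @card_good_perms N.
have -> : (N < 3) = false by lia.
by rewrite addn0; apply; lia.
Qed.
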